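(* Let $X_0,X_1,X_2$ be quasi-independent real random variables with a given generator $\eta$, and let $F_i$ be the distribution function of $X_i$, $i=0,1,2$. Suppose that there exist $a,b,x_0,q$ satisfying $-\infty\le a,x_0<b\le\infty$ and $0<q<1$ such that $$F_1(x)<1 \text{ for } x<b;\quad F_1(b-0)=1 \text{ if } b\in\mathbb{R},$$ $$F_2(y)>0 \text{ for } y>a;\quad F_2(a+0)=0 \text{ if } a\in\mathbb{R},$$ $$F_0(a+0)=0,\quad F_0(b-0)=1,\quad F_0(x_0)=q,$$ and $F_0$ is strictly increasing in the interval $(a,b)$. Let $Y_1=\min(X_0,X_1)$ and $Y_2=\max(X_0,X_2)$. Then the joint distribution of $(Y_1,Y_2)$ uniquely determines $F_0,F_1$ and $F_2$ given the generator $\eta$. That is, if $X_0^*,X_1^*,X_2^*$ are quasi-independent real random variables with the same generator $\eta$, whose distribution functions $F_0^*,F_1^*,F_2^*$ satisfy the conditions displayed above (with the same $a,b,x_0,q$, and with $F_0^*$ strictly increasing in $(a,b)$), and if $(\min(X_0^*,X_1^* ),\max(X_0^*,X_2^* ))$ has the same joint distribution as $(Y_1,Y_2)$, then $F_i^*=F_i$ for $i=0,1,2$.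
   Context: Real random variables $X_1,\dots,X_n$ are called quasi-independent if there exists a set function $\eta$, defined on products $B_1\times\dots\times B_n$ of Borel subsets of $\mathbb{R}$ and taking nonzero nonnegative real values, such that $\eta(B_1\times\dots\times B_n)=1$ whenever at least one of the sets $B_i$ is $\mathbb{R}$, and $$P(X_1\in B_1,\dots,X_n\in B_n)=\prod_{j=1}^n P(X_j\in B_j)\;\eta(B_1\times\dots\times B_n)$$ for all Borel subsets $B_1,\dots,B_n$ of $\mathbb{R}$. The function $\eta$ is called the generator of the random vector $(X_1,\dots,X_n)$. The definition is applied here to three variables indexed by $0,1,2$. The distribution function of $X$ is $F(x)=P(X\le x)$. $F(c-0)$ and $F(c+0)$ denote the left and right limits of $F$ at $c$, with $F(-\infty+0)$ and $F(\infty-0)$ the limits at $-\infty$ and $\infty$. *)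

(* Defs.v *)
From HB Require Import structures.
From mathcomp Require Import all_boot all_order all_algebra.
From mathcomp Require Import all_classical all_reals all_analysis.
From mathcomp Require Import measurable_realfun.

Set Implicit Arguments.
Unset Strict Implicit.
Unset Printing Implicit Defensive.

Import Order.TTheory GRing.Theory Num.Theory.
Import numFieldNormedType.Exports.

Local Open Scope classical_set_scope.
Local Open Scope ring_scope.

Definition box (R : realType) (n : nat) (B : 'I_n -> set R) : set ('I_n -> R) :=
  [set x | forall i, B i (x i)].

(* [eta] is a function of the set B_1 x ... x B_n, not of the tuple of its
   factors; its values on sets that are not boxes of Borel sets are irrelevant.
   "Nonzero nonnegative" is read as "positive on every box of Borel sets". *)
Record quasi_independent (d : measure_display) (T : measurableType d)
    (R : realType) (P : probability T R) (n : nat) (X : 'I_n -> {RV P >-> R})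
    (eta : set ('I_n -> R) -> R) : Prop := QuasiIndependent {
  generator_gt0 : forall B : 'I_n -> set R,
    (forall i, measurable (B i)) -> 0 < eta (box B) ;
  generator_setT : forall B : 'I_n -> set R,
    (forall i, measurable (B i)) -> (exists i, B i = [set: R]) ->
    eta (box B) = 1 ;
  generatorE : forall B : 'I_n -> set R,
    (forall i, measurable (B i)) ->
    P [set w | forall i, B i (X i w)] =
      ((\prod_(i < n) P (X i @^-1` B i)) * (eta (box B))%:E)%E
}.

(* The filter for the limit at c + 0, with c possibly -oo. The value at +oo,
   where there is no right limit, is a dummy. *)
Definition right_of (R : realType) (c : \bar R) : set_system R :=
  match c with
  | r%:E => r^'+
  | -oo => -oo_R
  | +oo => +oo_R
  end%E.

(* The filter for the limit at c - 0; the value at -oo is a dummy. *)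
Definition left_of (R : realType) (c : \bar R) : set_system R :=
  match c with
  | r%:E => r^'-
  | +oo => +oo_R
  | -oo => -oo_R
  end%E.

Record cdf_conditions (R : realType) (a b : \bar R) (x0 q : R)
    (F0 F1 F2 : R -> \bar R) : Prop := CdfConditions {
  cdf1_lt1 : forall x : R, (x%:E < b)%E -> (F1 x < 1)%E ;
  cdf1_left_b : b \is a fin_num -> F1 x @[x --> left_of b] --> 1%E ;
  cdf2_gt0 : forall y : R, (a < y%:E)%E -> (0 < F2 y)%E ;
  cdf2_right_a : a \is a fin_num -> F2 y @[y --> right_of a] --> 0%E ;
  cdf0_right_a : F0 x @[x --> right_of a] --> 0%E ;
  cdf0_left_b : F0 x @[x --> left_of b] --> 1%E ;
  cdf0_x0 : F0 x0 = q%:E ;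
  cdf0_incr : forall x y : R,
    (a < x%:E)%E -> x < y -> (y%:E < b)%E -> (F0 x < F0 y)%E
}.

Definition min_max (d : measure_display) (T : measurableType d)
    (R : realType) (P : probability T R) (X : 'I_3 -> {RV P >-> R}) (w : T) :
    R * R :=
  (Num.min (X 0 w) (X 1 w), Num.max (X 0 w) (X 2 w)).

Section min_max_measurable.
Context (d : measure_display) (T : measurableType d) (R : realType)
  (P : probability T R) (X : 'I_3 -> {RV P >-> R}).

Lemma measurable_min_max : measurable_fun [set: T] (min_max X).
Proof.
apply: measurable_fun_pair.
- exact: (measurable_minr (measurable_funPT (X 0)) (measurable_funPT (X 1))).
- exact: (measurable_maxr (measurable_funPT (X 0)) (measurable_funPT (X 2))).
Qed.

HB.instance Definition _ :=
  isMeasurableFun.Build _ _ _ _ (min_max X) measurable_min_max.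

End min_max_measurable.

(* Main.v *)
Require Import Defs.
From mathcomp Require Import all_boot all_order all_algebra.
From mathcomp Require Import all_classical all_reals all_analysis.
From mathcomp Require Import measurable_realfun.
From mathcomp Require Import ring.

Import Order.TTheory GRing.Theory Num.Theory.
Import numFieldNormedType.Exports.

Local Open Scope classical_set_scope.
Local Open Scope ring_scope.

(** Since the generator equals 1 as soon as one factor of the box is the whole
line, any two of the three variables are independent. Hence the marginal laws
of [Y1 = min (X0, X1)] and [Y2 = max (X0, X2)] do not involve [eta]:
[P (Y1 > u) = (1 - F0 u) (1 - F1 u)] and [P (Y2 <= v) = F0 v * F2 v].
On the other hand, for [u < v], the event [Y1 > u, Y2 <= v] is
[X0 in (u, v], X1 > u, X2 <= v], of probability
[(F0 v - F0 u) (1 - F1 u) (F2 v) eta (box)], where the box depends on [u] and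
[v] alone and [eta (box) > 0] (lemmas [min_law], [max_law], [min_max_law]).

Dividing the joint probability by both marginal ones makes [F1] and [F2]
disappear: the common law of [(Y1, Y2)] and the generator determine
[(F0 v - F0 u) / ((1 - F0 u) F0 v) = 1 - O u / O v], where
[O = F0 / (1 - F0)] is the odds function of [X0]. So the ratios [O u / O v]
are determined for [a < u < v < b] ([same_odds_ratio]). As [F0 x0 = q] lies
strictly between 0 and 1, the point [x0] lies in [(a, b)] and [O x0] is known,
so that [O], and with it [F0], is determined on [(a, b)] ([fcdf0_unique]).
The limit conditions give [F0 = 0] and [F2 = 0] up to [a], and [F0 = 1] and
[F1 = 1] from [b] on. Finally [F1] below [b] and [F2] above [a] come from the
marginal laws after division by [1 - F0 u > 0] and [F0 v > 0]. *)

(** * Algebra and monotone limits *)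

(** The product [((1 - s) * r) * (t * f)] cancels from the third equation,
leaving [1 - o s / o t = 1 - o s' / o t'] for the odds [o x = x / (1 - x)]; the
conclusion is the equality of these odds ratios cleared of its denominators. *)
Lemma odds_ratio_identity {F : idomainType} (s t r f s' t' r' f' e : F) :
  (1 - s) * r != 0 -> t * f != 0 -> e != 0 ->
  (1 - s) * r = (1 - s') * r' -> t * f = t' * f' ->
  (t - s) * (r * f) * e = (t' - s') * (r' * f') * e ->
  s * (1 - t) * ((1 - s') * t') = s' * (1 - t') * ((1 - s) * t).
Proof.
move=> sr0 tf0 e0 Er Ef /(mulIf e0) E.
suff E' : (t - s) * ((1 - s') * t') = (t' - s') * ((1 - s) * t).
  transitivity ((1 - s) * t * ((1 - s') * t') - (t - s) * ((1 - s') * t')).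
    by ring.
  by rewrite E'; ring.
apply: (mulIf (mulf_neq0 sr0 tf0)).
transitivity ((t - s) * (r * f) * ((1 - s') * t') * ((1 - s) * t)); first by ring.
rewrite E.
transitivity ((t' - s') * ((1 - s') * r') * (t' * f') * ((1 - s) * t)); first by ring.
by rewrite -Er -Ef; ring.
Qed.

(** The limit of a monotone function is compared with its value at [x] because
the points of the filter eventually lie on one side of [x]. This covers
[c = +oo], where [right_of c] is the filter of neighbourhoods of [+oo]. *)
Lemma nondecreasing_le_right_lim {R : realType} (F : R -> \bar R) (c l : \bar R) (x : R) :
  nondecreasing_fun F -> F y @[y --> right_of c] --> l -> (x%:E <= c)%E ->
  (F x <= l)%E.
Proof.
move=> ndF; case: c => [c||] //= Fl xc.
- apply: (cvge_to_ge Fl); near=> y; apply: ndF.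
  move: xc; rewrite lee_fin => /le_trans; apply.
  by apply: ltW; near: y; exact: nbhs_right_gt.
- apply: (cvge_to_ge Fl); near=> y; apply: ndF.
  by near: y; exact: nbhs_pinfty_ge.
Unshelve. all: by end_near. Qed.

Lemma nondecreasing_ge_left_lim {R : realType} (F : R -> \bar R) (c l : \bar R) (x : R) :
  nondecreasing_fun F -> F y @[y --> left_of c] --> l -> (c <= x%:E)%E ->
  (l <= F x)%E.
Proof.
move=> ndF; case: c => [c||] //= Fl cx.
- apply: (cvge_to_le Fl); near=> y; apply: ndF.
  move: cx; rewrite lee_fin; apply: le_trans.
  by apply: ltW; near: y; exact: nbhs_left_lt.
- apply: (cvge_to_le Fl); near=> y; apply: ndF.
  by near: y; exact: nbhs_ninfty_le.
Unshelve. all: by end_near. Qed.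

Lemma exists_real_lt {R : realType} (c : \bar R) (x : R) :
  (c < x%:E)%E -> exists2 y, (c < y%:E)%E & y < x.
Proof.
case: c => [c||] // cx.
  by exists ((c + x) / 2); rewrite ?lte_fin midf_lt// -lte_fin.
by exists (x - 1); [exact: ltNyr | rewrite ltrBlDr ltrDl].
Qed.

Lemma exists_real_gt {R : realType} (c : \bar R) (x : R) :
  (x%:E < c)%E -> exists2 y, x < y & (y%:E < c)%E.
Proof.
case: c => [c||] // xc.
  by exists ((x + c) / 2); rewrite ?lte_fin midf_lt// -lte_fin.
by exists (x + 1); [rewrite ltrDl | exact: ltry].
Qed.

Lemma ord3P (i : 'I_3) : [\/ i = 0, i = 1 | i = 2].
Proof.
case: i => -[|[|[|//]]] i.
- by apply: Or31; exact: val_inj.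
- by apply: Or32; exact: val_inj.
- by apply: Or33; exact: val_inj.
Qed.

(** * The law of the minimum and the maximum *)

Section one_variable.
Context {d : measure_display} {T : measurableType d} {R : realType}
  {P : probability T R}.
Implicit Type X : {RV P >-> R}.

Definition fcdf X (x : R) : R := fine (cdf X x).

Lemma cdfE X x : cdf X x = (fcdf X x)%:E.
Proof. by rewrite /fcdf fineK// fin_num_measure. Qed.

Lemma prob_itvNy X v : P (X @^-1` `]-oo, v]) = (fcdf X v)%:E.
Proof. by rewrite -cdfE. Qed.

Lemma prob_itvy X u : P (X @^-1` `]u, +oo[) = (1 - fcdf X u)%:E.
Proof. by rewrite EFinB -cdfE; exact: ccdf_1_cdf. Qed.

Lemma prob_itv X u v : u < v ->
  P (X @^-1` `]u, v]) = (fcdf X v - fcdf X u)%:E.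
Proof.
move=> uv; rewrite EFinB -!cdfE /cdf.
rewrite (_ : `]-oo, v]%classic = `]-oo, u] `|` `]u, v]); last first.
  by rewrite -itv_bndbnd_setU// bnd_simp ltW.
rewrite measureU//; first by rewrite addeAC subee ?add0e// fin_num_measure.
rewrite -subset0 => z [/=]; rewrite !in_itv/= => zu /andP[uz _].
by move: (lt_le_trans uz zu); rewrite ltxx.
Qed.

End one_variable.

Section min_max_law.
Context {d : measure_display} {T : measurableType d} {R : realType}
  {P : probability T R} {X : 'I_3 -> {RV P >-> R}}
  {eta : set ('I_3 -> R) -> R} (hX : quasi_independent X eta).

Definition tripleset (A B C : set R) : 'I_3 -> set R :=
  fun i => nth setT [:: A; B; C] i.

Lemma measurable_tripleset {A B C} : measurable A -> measurable B ->
  measurable C -> forall i, measurable (tripleset A B C i).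
Proof. by move=> mA mB mC i; have [->|->|->] := ord3P i. Qed.

Lemma prob_triple {A B C} : measurable A -> measurable B -> measurable C ->
  P [set w | [/\ A (X 0 w), B (X 1 w) & C (X 2 w)]] =
  (P (X 0%R @^-1` A) * P (X 1%R @^-1` B) * P (X 2%R @^-1` C) *
   (eta (box (tripleset A B C)))%:E)%E.
Proof.
move=> mA mB mC; have := generatorE hX (measurable_tripleset mA mB mC).
rewrite !big_ord_recl big_ord0 mule1 /= => E.
rewrite (_ : [set w | _] = [set w | forall i, tripleset A B C i (X i w)]).
  have i1 : lift ord0 ord0 = 1 :> 'I_3 by exact: val_inj.
  have i2 : lift ord0 (lift ord0 ord0) = 2 :> 'I_3 by exact: val_inj.
  by rewrite E i1 i2 !muleA.
apply/seteqP; split => w /=.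
  by case=> Aw Bw Cw i; have [->|->|->] := ord3P i.
by move=> h; split; [exact: (h 0)|exact: (h 1)|exact: (h 2)].
Qed.

Notation F i := (fcdf (X i)).

(** [Y1 > u] leaves [X2] free, so the generator takes the value 1. *)
Lemma min_law u : distribution P (min_max X) (`]u, +oo[ `*` setT) =
  ((1 - F 0 u) * (1 - F 1 u))%:E.
Proof.
transitivity (P [set w | [/\ `]u, +oo[%classic (X 0 w),
    `]u, +oo[%classic (X 1 w) & [set: R] (X 2 w)]]).
  congr (P _); apply/seteqP; split=> w /=; rewrite !in_itv/= !andbT lt_min.
    by case=> /andP[].
  by case=> -> ->.
rewrite prob_triple// (generator_setT hX); last by exists 2.
  by rewrite !prob_itvy preimage_setT probability_setT !mule1.
exact: measurable_tripleset.
Qed.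

Lemma max_law v : distribution P (min_max X) (setT `*` `]-oo, v]) =
  (F 0 v * F 2 v)%:E.
Proof.
transitivity (P [set w | [/\ `]-oo, v]%classic (X 0 w),
    [set: R] (X 1 w) & `]-oo, v]%classic (X 2 w)]]).
  congr (P _); apply/seteqP; split=> w /=; rewrite !in_itv/= ge_max.
    by case=> _ /andP[].
  by case=> -> _ ->.
rewrite prob_triple// (generator_setT hX); last by exists 1.
  by rewrite !prob_itvNy preimage_setT probability_setT !mule1.
exact: measurable_tripleset.
Qed.

(** [Y1 > u] bounds [X0] and [X1] from below and [Y2 <= v] bounds [X0] and
[X2] from above, so their intersection is a single box; this is where the
generator enters. *)
Lemma min_max_law u v : u < v ->
  distribution P (min_max X) (`]u, +oo[ `*` `]-oo, v]) =
  ((F 0 v - F 0 u) * ((1 - F 1 u) * F 2 v) *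
   eta (box (tripleset `]u, v] `]u, +oo[ `]-oo, v])))%:E.
Proof.
move=> uv.
transitivity (P [set w | [/\ `]u, v]%classic (X 0 w),
    `]u, +oo[%classic (X 1 w) & `]-oo, v]%classic (X 2 w)]]).
  congr (P _); apply/seteqP; split=> w /=;
    rewrite !in_itv/= !andbT lt_min ge_max.
    by case=> /andP[-> ->] /andP[-> ->].
  by case=> /andP[-> ->] -> ->.
by rewrite prob_triple// prob_itv// prob_itvy prob_itvNy -!EFinM !mulrA.
Qed.

End min_max_law.

(** * Bounds on the distribution functions *)

Section cdf_bounds.
Context {d : measure_display} {T : measurableType d} {R : realType}
  {P : probability T R} {X : 'I_3 -> {RV P >-> R}} {a b : \bar R} {x0 q : R}.
Hypothesis hF : cdf_conditions a b x0 q (cdf (X 0)) (cdf (X 1)) (cdf (X 2)).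
Hypothesis hab : (a < b)%E.
Implicit Type x : R.

Notation F i := (fcdf (X i)).

Lemma fcdf_ge0 i x : 0 <= F i x.
Proof. by rewrite -lee_fin -cdfE cdf_ge0. Qed.

Lemma fcdf_le1 i x : F i x <= 1.
Proof. by rewrite -lee_fin -cdfE cdf_le1. Qed.

Lemma fcdf0_eq0 x : (x%:E <= a)%E -> F 0 x = 0.
Proof.
move=> xa; apply/eqP; rewrite eq_le fcdf_ge0 -lee_fin -cdfE andbT.
exact: nondecreasing_le_right_lim (cdf_nondecreasing _) (cdf0_right_a hF) xa.
Qed.

(** The limit of [F2] at [a] is only prescribed for a real [a], which
[x <= a < b] guarantees. *)
Lemma fcdf2_eq0 x : (x%:E <= a)%E -> F 2 x = 0.
Proof.
move=> xa; apply/eqP; rewrite eq_le fcdf_ge0 -lee_fin -cdfE andbT.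
have fa : a \is a fin_num.
  by rewrite fin_real// (lt_le_trans (ltNyr x) xa) (lt_le_trans hab (leey b)).
exact: nondecreasing_le_right_lim (cdf_nondecreasing _) (cdf2_right_a hF fa) xa.
Qed.

Lemma fcdf0_eq1 x : (b <= x%:E)%E -> F 0 x = 1.
Proof.
move=> bx; apply/eqP; rewrite eq_le fcdf_le1 -lee_fin -cdfE.
exact: nondecreasing_ge_left_lim (cdf_nondecreasing _) (cdf0_left_b hF) bx.
Qed.

Lemma fcdf1_eq1 x : (b <= x%:E)%E -> F 1 x = 1.
Proof.
move=> bx; apply/eqP; rewrite eq_le fcdf_le1 -lee_fin -cdfE.
have fb : b \is a fin_num.
  by rewrite fin_real// (le_lt_trans (leNye a) hab) (le_lt_trans bx (ltry x)).
exact: nondecreasing_ge_left_lim (cdf_nondecreasing _) (cdf1_left_b hF fb) bx.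
Qed.

Lemma fcdf0_gt0 x : (a < x%:E)%E -> 0 < F 0 x.
Proof.
move=> ax; have [xb|bx] := ltP (x%:E)%E b; last by rewrite fcdf0_eq1.
have [y ay yx] := exists_real_lt _ _ ax.
apply: le_lt_trans (fcdf_ge0 0 y) _.
by rewrite -lte_fin -!cdfE (cdf0_incr hF).
Qed.

Lemma fcdf0_lt1 x : (x%:E < b)%E -> F 0 x < 1.
Proof.
move=> xb; have [ax|xa] := ltP a (x%:E)%E; last by rewrite fcdf0_eq0.
have [y xy yb] := exists_real_gt _ _ xb.
apply: lt_le_trans (fcdf_le1 0 y).
by rewrite -lte_fin -!cdfE (cdf0_incr hF).
Qed.

Lemma fcdf1_lt1 x : (x%:E < b)%E -> F 1 x < 1.
Proof. by move=> /(cdf1_lt1 hF); rewrite cdfE lte_fin. Qed.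

Lemma fcdf2_gt0 x : (a < x%:E)%E -> 0 < F 2 x.
Proof. by move=> /(cdf2_gt0 hF); rewrite cdfE lte_fin. Qed.

Lemma fcdf0_x0 : F 0 x0 = q.
Proof. by apply: EFin_inj; rewrite -cdfE (cdf0_x0 hF). Qed.

(** At or below [a] the function [F0] vanishes, whereas [F0 x0 = q > 0]. *)
Lemma a_lt_x0 : 0 < q -> (a < x0%:E)%E.
Proof.
move=> q0; rewrite ltNge; apply/negP => /fcdf0_eq0; rewrite fcdf0_x0 => E.
by rewrite E ltxx in q0.
Qed.

End cdf_bounds.

(** * Uniqueness *)

Section same_min_max_law.
Context {R : realType} {d d' : measure_display} {T : measurableType d}
  {T' : measurableType d'} {P : probability T R} {P' : probability T' R}
  {X : 'I_3 -> {RV P >-> R}} {X' : 'I_3 -> {RV P' >-> R}}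
  {eta : set ('I_3 -> R) -> R} {a b : \bar R} {x0 q : R}.
Hypothesis hX : quasi_independent X eta.
Hypothesis hF : cdf_conditions a b x0 q (cdf (X 0)) (cdf (X 1)) (cdf (X 2)).
Hypothesis hX' : quasi_independent X' eta.
Hypothesis hF' : cdf_conditions a b x0 q (cdf (X' 0)) (cdf (X' 1)) (cdf (X' 2)).
Hypothesis hY : forall B : set (R * R), measurable B ->
  distribution P' (min_max X') B = distribution P (min_max X) B.

Notation F i := (fcdf (X i)).
Notation F' i := (fcdf (X' i)).

Lemma same_min_law u : (1 - F 0 u) * (1 - F 1 u) = (1 - F' 0 u) * (1 - F' 1 u).
Proof.
apply: EFin_inj; rewrite -(min_law hX) -(min_law hX') hY//.
exact: measurableX.
Qed.

Lemma same_max_law v : F 0 v * F 2 v = F' 0 v * F' 2 v.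
Proof.
apply: EFin_inj; rewrite -(max_law hX) -(max_law hX') hY//.
exact: measurableX.
Qed.

(** The ratio of the odds of [X0] at [u] and at [v], cleared of denominators:
the positive number [eta (box)] is common to both systems and cancels. *)
Lemma same_odds_ratio u v : (a < v%:E)%E -> u < v -> (u%:E < b)%E ->
  F 0 u * (1 - F 0 v) * ((1 - F' 0 u) * F' 0 v) =
  F' 0 u * (1 - F' 0 v) * ((1 - F 0 u) * F 0 v).
Proof.
move=> av uv ub.
pose e := eta (box (tripleset `]u, v] `]u, +oo[ `]-oo, v])).
apply: (@odds_ratio_identity _ _ _ (1 - F 1 u) (F 2 v) _ _ (1 - F' 1 u)
  (F' 2 v) e).
- by apply: mulf_neq0; rewrite subr_eq0 gt_eqF// ?(fcdf0_lt1 hF)// (fcdf1_lt1 hF).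
- by apply: mulf_neq0; rewrite gt_eqF// ?(fcdf0_gt0 hF)// (fcdf2_gt0 hF).
- rewrite gt_eqF// (generator_gt0 hX)//; exact: measurable_tripleset.
- exact: same_min_law.
- exact: same_max_law.
- apply: EFin_inj; rewrite -(min_max_law hX)// -(min_max_law hX')// hY//.
  exact: measurableX.
Qed.

(** Fixing one of the two points of [same_odds_ratio] at [x0], where both
functions equal [q], leaves an equation that is linear in [F 0 x] and
[F' 0 x]. *)
Lemma fcdf0_unique (hx0 : (x0%:E < b)%E) (hq0 : 0 < q) (hq1 : q < 1) x :
  F' 0 x = F 0 x.
Proof.
have [ax|xa] := ltP a (x%:E)%E; last first.
  by rewrite (fcdf0_eq0 hF)// (fcdf0_eq0 hF').
have [xb|bx] := ltP (x%:E)%E b; last first.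
  by rewrite (fcdf0_eq1 hF)// (fcdf0_eq1 hF').
have ax0 : (a < x0%:E)%E := a_lt_x0 hF hq0.
have E0 := fcdf0_x0 hF; have E0' := fcdf0_x0 hF'.
have nz : q * (1 - q) != 0 by rewrite mulf_neq0 ?subr_eq0// gt_eqF.
have [xx0|x0x|->] := ltgtP x x0; last by rewrite E0 E0'.
- have := same_odds_ratio x x0 ax0 xx0 xb; rewrite E0 E0' => E.
  apply: (mulIf nz); apply: subr0_eq.
  transitivity (F' 0 x * (1 - q) * ((1 - F 0 x) * q) -
    F 0 x * (1 - q) * ((1 - F' 0 x) * q)); first by ring.
  by rewrite E subrr.
- have := same_odds_ratio x0 x ax x0x hx0; rewrite E0 E0' => E.
  apply: (mulIf nz); apply: subr0_eq.
  transitivity (q * (1 - F 0 x) * ((1 - q) * F' 0 x) -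
    q * (1 - F' 0 x) * ((1 - q) * F 0 x)); first by ring.
  by rewrite E subrr.
Qed.

End same_min_max_law.

Theorem theorem4p2 (R : realType)
    (d d' : measure_display) (T : measurableType d) (T' : measurableType d')
    (P : probability T R) (P' : probability T' R)
    (X : 'I_3 -> {RV P >-> R}) (X' : 'I_3 -> {RV P' >-> R})
    (eta : set ('I_3 -> R) -> R) (a b : \bar R) (x0 q : R)
    (hab : (a < b)%E) (hx0 : (x0%:E < b)%E) (hq0 : 0 < q) (hq1 : q < 1)
    (hX : quasi_independent X eta)
    (hF : cdf_conditions a b x0 q (cdf (X 0)) (cdf (X 1)) (cdf (X 2)))
    (hX' : quasi_independent X' eta)
    (hF' : cdf_conditions a b x0 q (cdf (X' 0)) (cdf (X' 1)) (cdf (X' 2)))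
    (hY : forall B : set (R * R), measurable B ->
      distribution P' (min_max X') B = distribution P (min_max X) B) :
  forall (i : 'I_3) (x : R), cdf (X' i) x = cdf (X i) x.
Proof.
have F0E x : fcdf (X' 0) x = fcdf (X 0) x.
  exact: fcdf0_unique hX hF hX' hF' hY hx0 hq0 hq1 x.
move=> i x; rewrite !cdfE; congr EFin.
have [->|->|->] := ord3P i.
- exact: F0E.
- have [xb|bx] := ltP (x%:E)%E b; last first.
    by rewrite (fcdf1_eq1 hF hab)// (fcdf1_eq1 hF' hab).
  have /mulfI cancel : 1 - fcdf (X 0) x != 0.
    by rewrite subr_eq0 gt_eqF// (fcdf0_lt1 hF).
  have := same_min_law hX hX' hY x; rewrite F0E => /cancel.
  by move=> /(congr1 (fun y => 1 - y)); rewrite !subKr.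
- have [ax|xa] := ltP a (x%:E)%E; last first.
    by rewrite (fcdf2_eq0 hF hab)// (fcdf2_eq0 hF' hab).
  have /mulfI cancel : fcdf (X 0) x != 0 by rewrite gt_eqF// (fcdf0_gt0 hF).
  by have := same_max_law hX hX' hY x; rewrite F0E => /cancel.
Qed.
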